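(* Let $q,\beta>0$ and let $0<\alpha<1$. For every $f\in C_B(\mathbb{R})$ and every $n\in\mathbb{N}$ with $n^{1-\alpha}>2$, put $$T:=\omega\left(f,\frac{1}{n^{\alpha}}\right)+\frac{2\left(q+\frac1q\right)\|f\|_\infty}{e^{\beta(n^{1-\alpha}-1)}}.$$ Then $$|B_n(f)(x)-f(x)|\le T\quad\text{for every }x\in\mathbb{R},\qquad\text{and}\qquad \|B_n(f)-f\|_\infty\le T.$$ Furthermore, for every $f\in C_{UB}(\mathbb{R})$, $\lim_{n\to\infty}B_n(f)=f$ pointwise and uniformly on $\mathbb{R}$.
   Context: $\mathbb{N}=\{1,2,\dots\}$. For $q,\beta>0$ and $x\in\mathbb{R}$ let $\nu_{q}(x)=\frac{1-qe^{-\beta x}}{1+qe^{-\beta x}}$ and $G_{q,\beta}(x)=\frac14\left(\nu_{q}(x+1)-\nu_{q}(x-1)\right)$; $G_{1/q,\beta}$ is the same with $q$ replaced by $1/q$. Let $\Psi=\frac12\left(G_{q,\beta}+G_{1/q,\beta}\right)$ (an even probability density on $\mathbb{R}$). $C_B(\mathbb{R})$ is the set of continuous bounded real functions on $\mathbb{R}$ and $C_{UB}(\mathbb{R})$ the set of uniformly continuous bounded ones. $\|\cdot\|_\infty$ is the supremum norm on $\mathbb{R}$. For $\theta>0$, $\omega(f,\theta)=\sup\{|f(x)-f(y)|: x,y\in\mathbb{R},\ |x-y|\le\theta\}$. The operator $B_n$ is $$B_n(f)(x)=\int_{-\infty}^{\infty}f\left(\frac vn\right)\Psi(nx-v)\,dv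 .$$ *)

(* Defs.v *)
From HB Require Import structures.
From mathcomp Require Import all_boot all_order all_algebra.
From mathcomp Require Import all_classical all_reals all_analysis.

Set Implicit Arguments.
Unset Strict Implicit.
Unset Printing Implicit Defensive.

Import Order.TTheory GRing.Theory Num.Theory.
Import numFieldNormedType.Exports.

Local Open Scope classical_set_scope.
Local Open Scope ring_scope.

Definition nu (R : realType) (q beta x : R) : R :=
  (1 - q * expR (- beta * x)) / (1 + q * expR (- beta * x)).

Definition G (R : realType) (q beta x : R) : R :=
  4%:R^-1 * (nu q beta (x + 1) - nu q beta (x - 1)).

Definition Psi (R : realType) (q beta x : R) : R :=
  2%:R^-1 * (G q beta x + G (1 / q) beta x).

Definition C_B (R : realType) : set (R -> R) :=
  [set f | continuous f /\ bounded_fun f].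

Definition C_UB (R : realType) : set (R -> R) :=
  [set f | unif_continuous f /\ bounded_fun f].

(* Suprema are taken in [\bar R], where they carry no default value: a finite
   bound on [supnorm g] does force [g] to be bounded. *)
Definition supnorm (R : realType) (g : R -> R) : \bar R :=
  ereal_sup [set `|g x|%:E | x in [set: R]].

Definition omega (R : realType) (f : R -> R) (theta : R) : \bar R :=
  ereal_sup [set `|f p.1 - f p.2|%:E | p in [set p : R * R | `|p.1 - p.2| <= theta]].

Definition B (R : realType) (q beta : R) (n : nat) (f : R -> R) (x : R) : R :=
  \int[lebesgue_measure]_v (f (v / n%:R) * Psi q beta (n%:R * x - v)).

(* Main.v *)
Require Import Defs.
From HB Require Import structures.
From mathcomp Require Import all_boot all_order all_algebra.
From mathcomp Require Import all_classical all_reals all_analysis.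
From mathcomp Require Import measurable_realfun ring lra.

Set Implicit Arguments.
Unset Strict Implicit.
Unset Printing Implicit Defensive.

Import Order.TTheory GRing.Theory Num.Theory.
Import numFieldNormedType.Exports.

Local Open Scope classical_set_scope.
Local Open Scope ring_scope.

(** The function [x + 2 / beta * ln (1 + q * exp (- beta * x))] is a primitive
    of [nu q beta], so [Psi] has an explicit primitive [F].  Since
    [nu q beta (- x) = - nu q^-1 beta x], averaging over [q] and [q^-1] makes
    [Psi] even and [F] odd.  The estimates [ln (1 + t) <= t] and
    [1 - exp (- 2 beta) <= 2 beta] give
    [0 <= 1/2 - F M <= (q + q^-1) / 2 * exp (- beta * (M - 1))], which yields
    both the total mass 1 of [Psi] and its tail mass [2 * (1/2 - F M)] outside
    [-M, M].  Splitting the integral of [(f (v / n) - f x) * Psi (n * x - v)]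
    at [|n * x - v| = M] bounds [|B_n f x - f x|] by the oscillation of [f] at
    scale [M / n] plus [2 * sup |f|] times the tail mass.  Taking
    [M = n `^ (1 - alpha)] gives the quantitative bound, and [M] proportional
    to [n] gives uniform convergence. *)

(** * Explicit primitives, symmetry and positivity of the kernel *)

Definition nu_primitive (R : realType) (q beta x : R) : R :=
  x + 2 / beta * ln (1 + q * expR (- beta * x)).

(** The factor [8%:R^-1] combines the 1/2 in [Psi] with the 1/4 in [G]. This choice of integration
    constant makes the primitive odd. *)
Definition Psi_primitive (R : realType) (q beta x : R) : R :=
  8%:R^-1 * (nu_primitive q beta (x + 1) - nu_primitive q beta (x - 1)
    + (nu_primitive q^-1 beta (x + 1) - nu_primitive q^-1 beta (x - 1))).

Lemma onePexp_gt0 (R : realType) (q x : R) : 0 < q -> 0 < 1 + q * expR x.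
Proof. by move=> q0; rewrite addr_gt0// mulr_gt0// expR_gt0. Qed.

Lemma nuN (R : realType) (q beta x : R) : 0 < q ->
  nu q beta (- x) = - nu q^-1 beta x.
Proof.
move=> q0; rewrite /nu mulrN mulNr opprK expRN.
have := @onePexp_gt0 R q (beta * x) q0.
have := expR_gt0 (beta * x); set e := expR _ => e0 d0.
by field; rewrite !gt_eqF//=; nra.
Qed.

Lemma PsiN (R : realType) (q beta x : R) : 0 < q ->
  Psi q beta (- x) = Psi q beta x.
Proof.
move=> q0; have qV0 : 0 < q^-1 by rewrite invr_gt0.
have xB : - x + 1 = - (x - 1) by ring.
have xD : - x - 1 = - (x + 1) by ring.
by rewrite /Psi /G div1r xB xD !nuN// invrK; ring.
Qed.

(** Both t = q exp(- beta x), as a function of x, and (1 - t) / (1 + t), as a function of t > 0, are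
    decreasing. *)
Lemma nu_homo (R : realType) (q beta : R) : 0 < q -> 0 < beta ->
  {homo nu q beta : x y / x <= y}.
Proof.
move=> q0 b0 x y xy; rewrite /nu.
have dx := @onePexp_gt0 R q (- beta * x) q0.
have dy := @onePexp_gt0 R q (- beta * y) q0.
have : expR (- beta * y) <= expR (- beta * x).
  by rewrite ler_expR ler_nM2l// oppr_lt0.
rewrite ler_pdivrMr// mulrAC ler_pdivlMr//.
by move: q0; set a := expR _; set b := expR _; nra.
Qed.

Lemma Psi_ge0 (R : realType) (q beta x : R) : 0 < q -> 0 < beta ->
  0 <= Psi q beta x.
Proof.
move=> q0 b0; have qV0 : 0 < q^-1 by rewrite invr_gt0.
rewrite /Psi /G div1r mulr_ge0 ?invr_ge0// addr_ge0// mulr_ge0 ?invr_ge0//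
  subr_ge0 nu_homo//; lra.
Qed.

(** With e = exp(- beta x), the logarithmic term has derivative - 2 q e / (1 + q e); adding 1 gives
    [nu]. *)
Lemma is_derive_nu_primitive (R : realType) (q beta x : R) : 0 < q -> 0 < beta ->
  is_derive x 1 (nu_primitive q beta) (nu q beta x).
Proof.
move=> q0 b0; have d0 := @onePexp_gt0 R q (- beta * x) q0.
rewrite /nu_primitive.
have h : is_derive x 1 (fun x : R => 1 + q * expR (- beta * x))
    (- q * beta * expR (- beta * x)).
  by apply: is_derive_eq; rewrite /GRing.scale/=; ring.
have := is_derive1_ln d0 => l.
have h2 := @is_derive1_comp R (@ln R)
  (fun x : R => 1 + q * expR (- beta * x)) x _ _ l h.
have h3 := is_deriveD (is_derive_id x (1 : R)) (is_deriveZ (2 / beta) h2).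
apply: (is_derive_eq h3).
by rewrite /nu /GRing.scale/=; field; rewrite !gt_eqF.
Qed.

Lemma is_derive_Psi_primitive (R : realType) (q beta x : R) :
  0 < q -> 0 < beta ->
  is_derive x 1 (Psi_primitive q beta) (Psi q beta x).
Proof.
move=> q0 b0; have qV0 : 0 < q^-1 by rewrite invr_gt0.
have h p c : 0 < p ->
  is_derive x 1 (fun y => nu_primitive p beta (y + c)) (nu p beta (x + c)).
  move=> p0; have d := is_derive_nu_primitive (x + c) p0 b0.
  have s : is_derive x 1 (fun y : R => y + c) 1.
    by apply: is_derive_eq; rewrite addr0.
  have := @is_derive1_comp R (nu_primitive p beta) (fun y => y + c) x _ _ d s.
  by rewrite mulr1.
have d := is_deriveZ 8%:R^-1
  (is_deriveD (is_deriveB (h _ 1 q0) (h _ (- 1) q0))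
              (is_deriveB (h _ 1 qV0) (h _ (- 1) qV0))).
apply: (is_derive_eq d).
by rewrite /Psi /G div1r /GRing.scale/=; field.
Qed.

Lemma continuous_Psi (R : realType) (q beta : R) : 0 < q -> 0 < beta ->
  continuous (Psi q beta).
Proof.
move=> q0 b0; have qV0 : 0 < q^-1 by rewrite invr_gt0.
have h p c (x : R) : 0 < p -> {for x, continuous (fun y => nu p beta (y + c))}.
  move=> p0; rewrite /nu.
  have ce : {for x, continuous (fun y => p * expR (- beta * (y + c)))}.
    apply: continuousM; first exact: cst_continuous.
    apply: continuous_comp; last exact: continuous_expR.
    apply: continuousM; first exact: cst_continuous.
    by apply: continuousD => //; exact: cst_continuous.
  apply: continuousM; first by apply: continuousB => //; exact: cst_continuous.
  apply: continuousV; first by rewrite gt_eqF// onePexp_gt0.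
  by apply: continuousD => //; exact: cst_continuous.
suff g x : {for x, continuous (Psi q beta)} by move=> x; exact: g.
have hG p : 0 < p -> {for x, continuous (G p beta)}.
  move=> p0; apply: (continuousM (s := cst _)); first exact: cst_continuous.
  by apply: continuousB; exact: h.
apply: (continuousM (s := cst _)); first exact: cst_continuous.
by apply: continuousD; [exact: hG|apply: hG; rewrite div1r].
Qed.

(** Factoring q exp(beta x) out of the logarithm turns - x into x and leaves a constant, which
    cancels in the differences forming [Psi_primitive]. *)
Lemma nu_primitiveN (R : realType) (q beta x : R) : 0 < q -> 0 < beta ->
  nu_primitive q beta (- x) = nu_primitive q^-1 beta x + 2 / beta * ln q.
Proof.
move=> q0 b0; have qV0 : 0 < q^-1 by rewrite invr_gt0.
have d0 := @onePexp_gt0 R q^-1 (- beta * x) qV0.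
rewrite /nu_primitive mulrNN.
have -> : 1 + q * expR (beta * x) =
    q * expR (beta * x) * (1 + q^-1 * expR (- beta * x)).
  by rewrite mulNr expRN; have := expR_gt0 (beta * x); set e := expR _ => e0;
    field; rewrite !gt_eqF.
rewrite !lnM ?posrE ?mulr_gt0 ?expR_gt0// expRK; field; rewrite gt_eqF//.
Qed.

Lemma Psi_primitiveN (R : realType) (q beta x : R) : 0 < q -> 0 < beta ->
  Psi_primitive q beta (- x) = - Psi_primitive q beta x.
Proof.
move=> q0 b0; have qV0 : 0 < q^-1 by rewrite invr_gt0.
rewrite /Psi_primitive.
have -> : - x + 1 = - (x - 1) by ring.
have -> : - x - 1 = - (x + 1) by ring.
by rewrite !nu_primitiveN// invrK; ring.
Qed.

(** * Exponential tail bound for the primitive *)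

(** With a and b the values of q exp(- beta y) at y = x - 1 and y = x + 1, the increment is 2 - (2 /
    beta) (ln (1 + a) - ln (1 + b)). The difference of logarithms is nonnegative and at most (a - b)
    / (1 + b) <= a - b = a (1 - exp(- 2 beta)) <= 2 beta a. *)
Lemma nu_primitive_increment (R : realType) (q beta x : R) :
  0 < q -> 0 < beta ->
  2 - 4 * (q * expR (- (beta * (x - 1)))) <=
    nu_primitive q beta (x + 1) - nu_primitive q beta (x - 1) <= 2.
Proof.
move=> q0 b0; rewrite /nu_primitive.
set a := q * expR (- beta * (x - 1)); set b := q * expR (- beta * (x + 1)).
have a0 : 0 < a by rewrite mulr_gt0// expR_gt0.
have b'0 : 0 < b by rewrite mulr_gt0// expR_gt0.
have ba : b <= a by rewrite /a /b ler_pM2l// ler_expR; nra.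
have bE : b = a * expR (- (2 * beta)).
  by rewrite /a /b -mulrA -expRD; congr (_ * expR _); ring.
have := expR_ge1Dx (- (2 * beta)) => e1.
have abl : a - b <= 2 * beta * a by rewrite bE; nra.
have l1 : ln (1 + b) <= ln (1 + a) by rewrite ler_ln ?posrE ?addr_gt0// lerD2l.
have l2 : ln (1 + a) - ln (1 + b) <= 2 * beta * a.
  rewrite -ln_div ?posrE ?addr_gt0//.
  have -> : (1 + a) / (1 + b) = 1 + (a - b) / (1 + b).
    by field; rewrite gt_eqF// addr_gt0.
  apply: (@le_trans _ _ ((a - b) / (1 + b))).
    by apply: le_ln1Dx; rewrite (@lt_le_trans _ _ 0)// divr_ge0 ?subr_ge0// addr_ge0 ?ltW.
  have ba0 : 0 <= 2 * beta * a by apply/ltW/mulr_gt0/a0/mulr_gt0.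
  by rewrite ler_pdivrMr ?addr_gt0// (le_trans abl)// ler_peMr// lerDl ltW.
rewrite -[- (beta * _)]mulNr -/a.
have -> : x + 1 + 2 / beta * ln (1 + b) - (x - 1 + 2 / beta * ln (1 + a)) =
  2 - 2 / beta * (ln (1 + a) - ln (1 + b)) by ring.
have bV : 0 < 2 / beta by rewrite divr_gt0.
apply/andP; split; last first.
  by rewrite lerBlDr lerDl mulr_ge0 ?subr_ge0// ltW.
apply: lerB => //.
apply: le_trans (ler_wpM2l (ltW bV) l2) _.
by rewrite le_eqVlt; apply/orP; left; apply/eqP; field; rewrite gt_eqF.
Qed.

(** The increments for [q] and [q^-1] add up to at most 4 and at least 4 - 4 (q + q^-1) exp(- beta
    (x - 1)); dividing by 8 gives both bounds. *)
Lemma Psi_primitive_tail (R : realType) (q beta x : R) :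
  0 < q -> 0 < beta ->
  0 <= 2^-1 - Psi_primitive q beta x <=
    2^-1 * ((q + q^-1) * expR (- (beta * (x - 1)))).
Proof.
move=> q0 b0; have qV0 : 0 < q^-1 by rewrite invr_gt0.
have := nu_primitive_increment x q0 b0.
have := nu_primitive_increment x qV0 b0.
rewrite /Psi_primitive.
move: (nu_primitive _ _ _ - _) (nu_primitive _ _ _ - _) (expR _) => a b e.
by lra.
Qed.

Lemma cvgy_expRNM (R : realType) (k : R) : 0 < k ->
  expR (- (k * x)) @[x --> +oo] --> (0 : R).
Proof.
move=> k0; apply: (@cvg_comp _ _ _ (fun x => k * x) (fun x => expR (- x)) _ +oo);
  last exact: cvgr_expR.
exact: gt0_cvgMry.
Qed.

Lemma cvgy_Psi_primitive (R : realType) (q beta : R) :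
  0 < q -> 0 < beta -> Psi_primitive q beta x @[x --> +oo] --> (2^-1 : R).
Proof.
move=> q0 b0.
have -> : Psi_primitive q beta = fun x => 2^-1 - (2^-1 - Psi_primitive q beta x).
  by apply/funext => x; ring.
rewrite -[X in _ --> X]subr0; apply: cvgB; first exact: cvg_cst.
(* The factor [expR beta] absorbs the shift in [x - 1]. *)
pose C := 2^-1 * (q + q^-1) * expR beta.
apply: (@squeeze_cvgr _ _ _ _ (cst 0) (fun x => C * expR (- (beta * x)))).
- near=> x; have /andP[-> /=] := Psi_primitive_tail x q0 b0.
  move/le_trans; apply; rewrite /C -!mulrA -expRD.
  by rewrite (_ : - (beta * (x - 1)) = beta - beta * x)//; ring.
- exact: cvg_cst.
- rewrite -[X in _ --> X](mulr0 C); apply: cvgM; first exact: cvg_cst.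
  exact: cvgy_expRNM.
Unshelve. all: by end_near. Qed.

(** * Mass of the translated kernel on half-lines and on the whole line *)

Lemma continuous_Psi_translate (R : realType) (q beta c : R) :
  0 < q -> 0 < beta -> continuous (fun v : R => Psi q beta (v - c)).
Proof.
move=> q0 b0 v.
apply: (@continuous_comp _ _ _ (fun v : R => v - c) (Psi q beta));
  last exact: continuous_Psi.
by apply: (@continuousB _ _ _ id (cst c)) => //; exact: cst_continuous.
Qed.

Lemma measurable_Psi_translate (R : realType) (q beta c : R) (D : set R) :
  0 < q -> 0 < beta -> measurable_fun D (fun v : R => Psi q beta (v - c)).
Proof.
move=> q0 b0; apply: measurable_funTS.
by apply: continuous_measurable_fun; exact: continuous_Psi_translate.
Qed.

Lemma integral_Psi_right (R : realType) (q beta c M : R) :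
  0 < q -> 0 < beta ->
  (\int[lebesgue_measure]_(v in `[(c + M)%R, +oo[) (Psi q beta (v - c))%:E =
    (2^-1 - Psi_primitive q beta M)%:E)%E.
Proof.
move=> q0 b0.
have dP (v : R) :
    is_derive v 1 (fun v : R => Psi_primitive q beta (v - c)) (Psi q beta (v - c)).
  have d := is_derive_Psi_primitive (v - c) q0 b0.
  have s : is_derive v 1 (fun y : R => y - c) 1.
    by apply: is_derive_eq; rewrite subr0.
  have := @is_derive1_comp R (Psi_primitive q beta) (fun y => y - c) v _ _ d s.
  by rewrite mulr1.
rewrite (@ge0_continuous_FTC2y _ _
  (fun v : R => Psi_primitive q beta (v - c)) _ 2^-1).
- by rewrite -EFinB addrAC subrr add0r.
- by move=> *; exact: Psi_ge0.
- by apply: continuous_subspaceT; exact: continuous_Psi_translate.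
- apply: (@cvg_comp _ _ _ (fun v : R => v - c) (Psi_primitive q beta) _ +oo);
    last exact: cvgy_Psi_primitive.
  exact: cvg_addrr.
- by move=> x _; exact: ex_derive.
- apply: cvg_at_right_filter.
  have : derivable (fun v : R => Psi_primitive q beta (v - c)) (c + M) 1.
    exact: ex_derive.
  by move=> /derivable1_diffP/differentiable_continuous.
- by move=> x _; rewrite derive1E; exact: derive_val.
Qed.

(** The substitution of - v for v, with evenness of [Psi], maps this tail to the right tail of the
    kernel centred at [- c]. *)
Lemma integral_Psi_left (R : realType) (q beta c M : R) :
  0 < q -> 0 < beta ->
  (\int[lebesgue_measure]_(v in `]-oo, (c - M)%R]) (Psi q beta (v - c))%:E =
    (2^-1 - Psi_primitive q beta M)%:E)%E.
Proof.
move=> q0 b0.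
rewrite -(integral_Psi_right (- c) M q0 b0).
have -> : c - M = - (- c + M) by rewrite opprD opprK.
rewrite ge0_integration_by_substitutionNy.
- by apply: eq_integral => v _ /=; rewrite opprK -PsiN// opprB opprK addrC.
- by apply: continuous_subspaceT; exact: continuous_Psi_translate.
- by move=> *; exact: Psi_ge0.
Qed.

(** Cutting at [c] gives the two tails with [M = 0]; each has mass 1/2 because the odd primitive
    vanishes at 0. *)
Lemma integral_Psi (R : realType) (q beta c : R) : 0 < q -> 0 < beta ->
  (\int[lebesgue_measure]_v (Psi q beta (v - c))%:E = 1)%E.
Proof.
move=> q0 b0.
have P0 : Psi_primitive q beta 0 = 0.
  by have := Psi_primitiveN 0 q0 b0; rewrite oppr0; lra.
have mP (D : set R) : measurable_fun D (fun v : R => Psi q beta (v - c)).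
  exact: measurable_Psi_translate.
have -> : [set: R] = `]-oo, c]%classic `|` `]c, +oo[%classic.
  by rewrite -itv_bndbnd_setU// set_itvNyy.
rewrite ge0_integral_setU//=.
(* The right half is open at [c], whereas the tail formula is for the closed ray; the endpoint is
   negligible. *)
- rewrite integral_itv_obnd_cbnd; last by apply/measurable_EFinP; exact: mP.
  have := integral_Psi_left c 0 q0 b0; rewrite subr0 => ->.
  have := integral_Psi_right c 0 q0 b0; rewrite addr0 => ->.
  by rewrite P0 subr0 -EFinD; congr EFin; field.
- by apply/measurable_EFinP; exact: mP.
- by move=> v _; rewrite lee_fin Psi_ge0.
- by apply/disj_setPS => v /=; rewrite !in_itv/= andbT leNgt => -[/negP].
Qed.

Lemma integrable_Psi (R : realType) (q beta c : R) : 0 < q -> 0 < beta ->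
  lebesgue_measure.-integrable setT (fun v : R => (Psi q beta (v - c))%:E).
Proof.
move=> q0 b0; apply/integrableP; split.
  by apply/measurable_EFinP; exact: measurable_Psi_translate.
under eq_integral do rewrite /= ger0_norm ?Psi_ge0//.
by rewrite integral_Psi// ltry.
Qed.

Lemma integral_Psi_far (R : realType) (q beta c M : R) :
  0 < M -> 0 < q -> 0 < beta ->
  (\int[lebesgue_measure]_(v in `]-oo, (c - M)%R] `|` `[(c + M)%R, +oo[)
      (Psi q beta (v - c))%:E =
    (2 * (2^-1 - Psi_primitive q beta M))%:E)%E.
Proof.
move=> M0 q0 b0.
etransitivity.
  apply: ge0_integral_setU.
  - exact: measurable_itv.
  - exact: measurable_itv.
  - by apply/measurable_EFinP; exact: measurable_Psi_translate.
  - by move=> v _; rewrite lee_fin Psi_ge0.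
  - apply/disj_setPS => v /=; rewrite !in_itv/= andbT => -[v1 v2].
    by move: M0; apply/negP; rewrite -leNgt; lra.
rewrite (integral_Psi_left c M q0 b0) (integral_Psi_right c M q0 b0) -EFinD.
by congr EFin; rewrite mulr_natl mulr2n.
Qed.

(** * From kernel mass to approximation error *)

(** Pointwise, |g p| is at most w p + t p 1_E. Keeping w p on the whole space makes its coefficient
    the total mass, so only the mass of [E] has to be estimated. *)
Lemma le_weighted_integral d (T : measurableType d) (R : realType)
    (mu : {measure set T -> \bar R}) (g p : T -> R) (w t : R) (E : set T) :
  measurable E -> measurable_fun setT g -> measurable_fun setT p ->
  (forall v, 0 <= p v) -> 0 <= w -> 0 <= t ->
  (forall v, ~ E v -> `|g v| <= w) -> (forall v, `|g v| <= t) ->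
  (\int[mu]_v `|g v * p v|%:E <=
    w%:E * \int[mu]_v (p v)%:E + t%:E * \int[mu]_(v in E) (p v)%:E)%E.
Proof.
move=> mE mg mp p0 w0 t0 gw gt.
have mp' D : measurable_fun D (EFin \o p).
  by apply/measurable_EFinP; exact: measurable_funTS.
have mpE : measurable_fun setT ((EFin \o p) \_ E).
  exact/(measurable_restrictT _ _).1.
have pE0 v : (0 <= ((EFin \o p) \_ E) v)%E.
  by apply: erestrict_ge0 => y _; rewrite lee_fin.
(* Extending [p] by zero outside [E] puts all integrals on the same domain. *)
rewrite [X in (_ <= _ + t%:E * X)%E]integral_mkcond.
rewrite -[X in (_ <= X + _)%E]ge0_integralZl//; last first.
  by move=> v _; rewrite lee_fin.
rewrite -[X in (_ <= _ + X)%E]ge0_integralZl//.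
have mwp : measurable_fun setT (fun v => w%:E * (p v)%:E)%E.
  exact: measurable_funeM (mp' setT).
have mtp : measurable_fun setT (fun v => t%:E * ((EFin \o p) \_ E) v)%E.
  exact: measurable_funeM.
rewrite -ge0_integralD//; last 2 first.
- by move=> v _; rewrite mule_ge0// lee_fin.
- by move=> v _; rewrite mule_ge0.
apply: ge0_le_integral => //.
- apply/measurable_EFinP; apply: measurableT_comp => //.
  exact: measurable_funM.
- exact: emeasurable_funD.
- move=> v _; rewrite patchE normrM (ger0_norm (p0 v)).
  case: ifPn => [_|/negP vE].
    rewrite -!EFinM -EFinD lee_fin -[leLHS]add0r lerD ?mulr_ge0//.
    by rewrite ler_wpM2r.
  rewrite mule0 adde0 -EFinM lee_fin ler_wpM2r// gw//.
  by move=> Ev; apply: vE; rewrite inE.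
Qed.

(** The radius [M] and the local oscillation bound [w] stay free, so that this estimate serves both
    the quantitative bound and the uniform limit. *)
Lemma B_approx (R : realType) (q beta : R) (f : R -> R) (n : nat)
    (x w s M : R) :
  0 < q -> 0 < beta -> (0 < n)%N -> 0 < M -> continuous f ->
  (forall y, `|f y| <= s) ->
  0 <= w -> (forall y, `|y - x| <= M / n%:R -> `|f y - f x| <= w) ->
  `|B q beta n f x - f x| <=
    w + 2 * (q + q^-1) / expR (beta * (M - 1)) * s.
Proof.
move=> q0 b0 n0 M0 cf fs w0 fw.
have n0' : 0 < n%:R :> R by rewrite ltr0n.
have s0 : 0 <= s by apply: le_trans (fs 0).
pose c := n%:R * x; pose p (v : R) := Psi q beta (v - c).
have p0 v : 0 <= p v by exact: Psi_ge0.
have ip : lebesgue_measure.-integrable setT (EFin \o p) by exact: integrable_Psi.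
have mp (D : set R) : measurable_fun D p by exact: measurable_Psi_translate.
have cfn : continuous (fun v : R => f (v / n%:R)).
  move=> v; apply: (@continuous_comp _ _ _ (fun v : R => v / n%:R) f);
    last exact: cf.
  by apply: (@continuousM _ _ id (cst _)) => //; exact: cst_continuous.
have mf : measurable_fun setT (fun v : R => f (v / n%:R)).
  exact: continuous_measurable_fun.
(* Linearity of the real-valued integral requires integrability; here [s * p] dominates. *)
have ifp : lebesgue_measure.-integrable setT
    (fun v : R => (f (v / n%:R) * p v)%:E).
  have isp : lebesgue_measure.-integrable setT (fun v : R => (s * p v)%:E).
    by under eq_fun do rewrite EFinM; exact: integrableZl.
  apply: (le_integrable measurableT _ _ isp).
  - by apply/measurable_EFinP; apply: measurable_funM; [exact: mf|exact: mp].
  - move=> v _; rewrite lee_fin !normrM ler_wpM2r// (le_trans (fs _))//.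
    exact: ler_norm.
have icp : lebesgue_measure.-integrable setT (fun v : R => (f x * p v)%:E).
  by under eq_fun do rewrite EFinM; exact: integrableZl.
have Ip : \int[lebesgue_measure]_v p v = 1 by rewrite /Rintegral integral_Psi.
have Bp : B q beta n f x = \int[lebesgue_measure]_v (f (v / n%:R) * p v).
  by apply: eq_Rintegral => v _; rewrite /p -(PsiN _ (v - c) q0) opprB.
(* Unit mass turns the constant [f x] into an integral against the same kernel. *)
have fxp : f x = \int[lebesgue_measure]_v (f x * p v).
  by rewrite (RintegralZl _ measurableT ip) Ip mulr1.
have -> : B q beta n f x - f x =
    \int[lebesgue_measure]_v (f (v / n%:R) * p v - f x * p v).
  rewrite Bp {1}fxp; symmetry; exact: (RintegralB measurableT ifp icp).
have ig : lebesgue_measure.-integrable setT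
    (fun v : R => (f (v / n%:R) * p v - f x * p v)%:E).
  by under eq_fun do rewrite EFinB; exact: integrableB.
have [mg _] := integrableP _ _ _ ig.
rewrite -lee_fin (EFin_normr_Rintegral measurableT ig).
apply: le_trans (le_abse_integral _ measurableT mg) _ => /=.
pose E : set R := `]-oo, c - M] `|` `[c + M, +oo[.
under eq_integral do rewrite -mulrBl.
(* Outside [E], |v - n x| < M, that is, v / n is within M / n of x. *)
have gw v : ~ E v -> `|f (v / n%:R) - f x| <= w.
  move=> /not_orP[]/=; rewrite !in_itv/= andbT => /negP; rewrite -ltNge => v1.
  move=> /negP; rewrite -ltNge => v2; apply: fw.
  have -> : v / n%:R - x = (v - c) / n%:R by rewrite /c; field; rewrite gt_eqF.
  rewrite normrM (gtr0_norm (_ : 0 < n%:R^-1)) ?invr_gt0// ler_pM2r ?invr_gt0// ler_norml.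
  by apply/andP; split; lra.
have gs v : `|f (v / n%:R) - f x| <= 2 * s.
  apply: le_trans (ler_normB _ _) _.
  by have := fs (v / n%:R); have := fs x; lra.
have mE : measurable E by apply: measurableU; exact: measurable_itv.
have mfx : measurable_fun setT (fun v : R => f (v / n%:R) - f x).
  by apply: measurable_funB => //; exact: measurable_cst.
have s20 : 0 <= 2 * s by rewrite mulr_ge0.
have := le_weighted_integral lebesgue_measure mE mfx (mp setT) p0 w0 s20 gw gs.
rewrite (integral_Psi_far c M0 q0 b0) (integral_Psi c q0 b0) mule1 -EFinM -EFinD.
move=> /le_trans; apply; rewrite lee_fin lerD2l.
have /andP[_] := Psi_primitive_tail M q0 b0; rewrite expRN => tail.
(* The right-hand side is the bound [2 * s] on the far oscillation times twice the one-sided tail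
   bound. *)
have -> : 2 * (q + q^-1) / expR (beta * (M - 1)) * s =
  2 * s * (2 * (2^-1 * ((q + q^-1) / expR (beta * (M - 1))))).
  by field; rewrite !gt_eqF// expR_gt0.
by rewrite ler_wpM2l// ler_wpM2l.
Qed.

(** * The quantitative estimate with extended-real suprema *)

(** The point [i0] excludes -oo and the bound [m] excludes +oo, so that [omega] and [supnorm] can be
    replaced by reals. *)
Lemma ereal_sup_bounded (R : realType) (I : Type) (D : set I) (g : I -> R)
    (i0 : I) (m : R) :
  D i0 -> (forall i, D i -> g i <= m) ->
  exists2 r, ereal_sup [set (g i)%:E | i in D] = r%:E &
    forall i, D i -> g i <= r.
Proof.
move=> Di0 gm; set S := ereal_sup _.
have gS i : D i -> ((g i)%:E <= S)%E.
  by move=> Di; apply: ereal_sup_ubound; exists i.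
have Sm : (S <= m%:E)%E.
  by apply: ge_ereal_sup => _ [i Di <-]; rewrite lee_fin gm.
case ES : S gS Sm => [r| |] gS Sm.
- by exists r => // i /gS; rewrite lee_fin.
- by [].
- by have := gS _ Di0; rewrite leeNy_eq.
Qed.

(** The radius M = n^(1 - alpha) is chosen so that M / n = n^(- alpha), the scale at which [omega]
    is taken. *)
Lemma C_B_approx (R : realType) (q beta alpha : R) (f : R -> R) (n : nat)
    (x : R) :
  0 < q -> 0 < beta -> C_B f -> (0 < n)%N ->
  (`|B q beta n f x - f x|%R%:E <=
     omega f (1 / n%:R `^ alpha) +
     (2%:R * (q + 1 / q) / expR (beta * (n%:R `^ (1 - alpha) - 1)))%:E
        * supnorm f)%E.
Proof.
move=> q0 b0 [cf bf] n0; have n0' : 0 < n%:R :> R by rewrite ltr0n.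
have [m fm] : exists m, forall y, `|f y| <= m.
  have [m [mreal fm]] := bf.
  exists (`|m| + 1) => y.
  by apply: fm => //; rewrite (le_lt_trans (ler_norm m))// ltrDl.
have [s Es fs] := @ereal_sup_bounded R R setT (fun y => `|f y|) 0 m Logic.I
  (fun y _ => fm y).
rewrite /supnorm Es.
set theta := 1 / _.
have theta0 : 0 < theta by rewrite /theta div1r invr_gt0 powR_gt0.
pose D := [set p : R * R | `|p.1 - p.2| <= theta].
(* This pair makes the supremum finite from below and later shows [0 <= w]. *)
have D0 : D (0, 0) by rewrite /D/= subrr normr0 ltW.
have fD p : D p -> `|f p.1 - f p.2| <= m + m.
  by move=> _; rewrite (le_trans (ler_normB _ _))// lerD.
have [w Ew fw] := ereal_sup_bounded D0 fD.
rewrite /omega Ew -EFinM -EFinD lee_fin div1r.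
apply: B_approx => //.
- by rewrite powR_gt0.
- by move=> y; exact: fs.
- exact: le_trans (fw _ D0).
- move=> y yx; apply: (fw (y, x)); rewrite /D/= (le_trans yx)//.
  rewrite /theta powRD ?powRr1 ?ler0n//; last first.
    by rewrite (gt_eqF n0') implybT.
  rewrite powRN mulrAC mulfV ?gt_eqF//.
Qed.

(** * Uniform convergence for uniformly continuous functions *)

(** With [d] a modulus of uniform continuity for e / 2 and M = n d / 2, the oscillation term is e /
    2 and the tail term decays exponentially in [n], uniformly in [x]. *)
Lemma B_uniform (R : realType) (q beta : R) (f : R -> R) (e : R) :
  0 < q -> 0 < beta -> C_UB f -> 0 < e ->
  \forall n \near \oo, forall x, `|f x - B q beta n f x| < e.
Proof.
move=> q0 b0 [ucf [m [mreal fm]]] e0.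
pose s := `|m| + 1.
have s0 : 0 < s by rewrite ltr_wpDl.
have fs y : `|f y| <= s.
  by apply: fm => //; rewrite (le_lt_trans (ler_norm m))// ltrDl.
have e20 : 0 < e / 2 by rewrite divr_gt0.
have /unif_continuousP/(_ _ e20)[d d0 fd] := ucf.
have cf : continuous f.
  move=> x; apply/cvgrPdist_lt => r r0.
  have /unif_continuousP/(_ _ r0)[d' d'0 fd'] := ucf.
  by near=> y; apply: (fd' (x, y)); near: y; exact: (nbhsx_ballx x d').
pose K := 2 * (q + q^-1) * s * expR beta.
near=> n => x.
have n0 : (0 < n)%N by near: n; exact: nbhs_infty_gt.
have n0' : 0 < n%:R :> R by rewrite ltr0n.
rewrite distrC; apply: le_lt_trans.
  (* Halving [d] turns the non-strict condition |y - x| <= M / n into the strict one defining the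
     ball of radius [d]. *)
  apply: (@B_approx R q beta f n x (e / 2) s (n%:R * (d / 2))) => //.
  - by rewrite mulr_gt0 ?divr_gt0.
  - exact: ltW.
  - move=> y; rewrite mulrAC mulfV ?gt_eqF// mul1r => yx.
    rewrite distrC ltW//; apply: (fd (x, y)); rewrite /ball/= distrC.
    by rewrite (le_lt_trans yx)// ltr_pdivrMr// ltr_pMr// ltr1n.
rewrite [ltRHS](splitr e) ltrD2l.
have -> : 2 * (q + q^-1) / expR (beta * (n%:R * (d / 2) - 1)) * s
    = K * expR (- (beta * (d / 2) * n%:R)).
  rewrite /K -expRN mulrAC -[in RHS]mulrA -expRD; congr (_ * expR _).
  by ring.
near: n.
have : K * expR (- (beta * (d / 2) * n%:R)) @[n --> \oo] --> (0 : R).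
  rewrite -[X in _ --> X](mulr0 K); apply: cvgM; first exact: cvg_cst.
  apply: (@cvg_comp _ _ _ (fun n : nat => n%:R : R)
    (fun y => expR (- (beta * (d / 2) * y))) _ +oo);
    first exact: cvgr_idn.
  by apply: cvgy_expRNM; rewrite mulr_gt0// divr_gt0.
by move=> /cvgr_lt; apply.
Unshelve. all: by end_near. Qed.

Theorem theorem2 (R : realType) (q beta alpha : R)
    (hq : 0 < q) (hbeta : 0 < beta) (halpha0 : 0 < alpha) (halpha1 : alpha < 1) :
  (forall f : R -> R, C_B f ->
   forall n : nat, (0 < n)%N -> 2%:R < n%:R `^ (1 - alpha) ->
   let T : \bar R :=
     (omega f (1 / n%:R `^ alpha) +
      (2%:R * (q + 1 / q) / expR (beta * (n%:R `^ (1 - alpha) - 1)))%:E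
        * supnorm f)%E in
   (forall x : R, (`|B q beta n f x - f x|%R%:E <= T)%E) /\
   (supnorm (fun x => B q beta n f x - f x)%R <= T)%E) /\
  (forall f : R -> R, C_UB f ->
   (forall x : R, B q beta n f x @[n --> \oo] --> f x) /\
   {uniform, (fun n : nat => B q beta n f) @ \oo --> f}).
Proof.
split=> [f fCB n n0 _ T|f fUB].
  have h x : (`|B q beta n f x - f x|%R%:E <= T)%E by exact: C_B_approx.
  by split=> //; apply: ge_ereal_sup => _ [x _ <-]; exact: h.
split=> [x|].
  apply/cvgrPdist_lt => e e0.
  by apply: filterS (B_uniform hq hbeta fUB e0) => n; exact.
move=> P /uniform_nbhs[E [entE EP]].
(* An entourage of the reals contains all pairs at distance less than some e > 0, which reduces
   uniform convergence to the estimate in [e]. *)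
have [e /= e0 eE] : exists2 e : R, 0 < e & [set xy | ball xy.1 e xy.2] `<=` E.
  by move: entE; rewrite -entourage_ballE => -[e e0 eE]; exists e.
apply: filterS (B_uniform hq hbeta fUB e0) => n Bn; apply: EP => x _.
by apply: eE => /=; exact: Bn.
Qed.
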